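(* The equivalence relation $E_0^{[\mathbb{Z}^2]}$ is not potentially $\mathbf{\Pi}^0_3$.
   Context: $E_0$ is the equivalence relation on $2^\omega$ given by $x\mathrel{E_0}y$ iff $x(n)=y(n)$ for all but finitely many $n$. For a countable group $\Gamma$ and an equivalence relation $E$ on a Polish space $X$, the $\Gamma$-jump $E^{[\Gamma]}$ is the equivalence relation on $X^\Gamma$ defined by $x\mathrel{E^{[\Gamma]}}y$ iff there is $\gamma\in\Gamma$ such that for all $\alpha\in\Gamma$, $x(\gamma^{-1}\alpha)\mathrel{E}y(\alpha)$. Here $\Gamma=\mathbb{Z}^2$. An equivalence relation $E$ on a Polish space $X$ is potentially $\mathbf{\Pi}^0_3$ if there is a Polish topology $\tau$ on $X$ with the same Borel sets such that $E$ is $\mathbf{\Pi}^0_3$ in $(X\times X,\tau\times\tau)$. *)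

(* Defs.v *)
From HB Require Import structures.
From mathcomp Require Import all_boot all_order all_algebra.
From mathcomp Require Import all_classical all_reals all_analysis.

Set Implicit Arguments.
Unset Strict Implicit.
Unset Printing Implicit Defensive.

Local Open Scope classical_set_scope.

(* A topology on a fixed carrier [X] is an inhabitant [tau] of the class
   [Topological X]; [Topological.Pack tau] is the resulting space.  Likewise a
   metric on [X], together with the topology it induces, is an inhabitant of
   [Metric R X]. *)

Definition complete_metric (R : realType) (M : metricType R) : Prop :=
  forall F : set_system M, ProperFilter F -> cauchy F -> exists l : M, F --> l.

Definition completely_metrizable (R : realType) (T : topologicalType) : Prop :=
  exists m : Metric R T,
    let M := Metric.Pack m : metricType R in
    @open M = @open T /\ complete_metric M.

Definition separable (T : topologicalType) : Prop :=
  exists2 D : set T, countable D & dense D.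

Definition polish (R : realType) (T : topologicalType) : Prop :=
  separable T /\ completely_metrizable R T.

Definition borel (T : topologicalType) : set_system T := <<s @open T >>.
Arguments borel : clear implicits.

(* Finite levels of the Borel hierarchy, numbered from 1: [Sigma0 1] is [open],
   and [Sigma0 n.+1] consists of the countable unions of [Pi0 n] sets.  There is
   no level 0, so [Sigma0 0] and [Pi0 0] are empty. *)
Fixpoint Sigma0 (T : topologicalType) (n : nat) (A : set T) : Prop :=
  match n with
  | 0 => False
  | 1 => open A
  | m.+1 => exists2 F : (set T)^nat,
      (forall i, Sigma0 m (~` F i)) & A = \bigcup_i F i
  end.

Definition Pi0 (T : topologicalType) (n : nat) (A : set T) : Prop :=
  Sigma0 n (~` A).

Definition potentially_Pi0 (R : realType) (n : nat) (X : topologicalType)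
    (E : X -> X -> Prop) : Prop :=
  exists tau : Topological X,
    let Y := Topological.Pack tau : topologicalType in
    [/\ polish R Y, borel Y = borel X &
        Pi0 n [set p : (Y * Y)%type | E p.1 p.2] ].

Definition E0 (x y : cantor_space) : Prop :=
  finite_set [set n | x n <> y n].

Definition jump (G : groupType) (T : Type) (E : T -> T -> Prop)
    (x y : {ptws G -> T}) : Prop :=
  exists g : G, forall a : G, E (x (g^-1 * a)%g) (y a).

(* The additive group of [int * int] viewed as a [groupType]. *)
Definition Z2 : groupType := GRing.to_multiplicative (int * int)%type.

(* Main.v *)
(* Take generic elements [x (i, c)] of [2^omega] for [c < 2^i], hence pairwise
   [E_0]-inequivalent, and put [x (|b|, a mod 2^|b|)] at position [(a, b)] of
   [Z^2].  A shift by an integer [g] rotates sheet [i], which consists of the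
   [x (i, c)], by [g] modulo [2^i].  A 2-adic integer [g] also acts by compatible
   rotations, but if [g] is not an integer then the result is not equivalent to
   the original.  In the image, sheet [i] is moreover modified arbitrarily below
   a generic cut-off [h i].  A basic open condition prescribes [h i] only for
   finitely many [i]; on those sheets [g] can be replaced by an integer, and on
   the others a large cut-off absorbs the difference.  So the pair formed by the
   original and its image under a generic 2-adic [g] is a limit of pairs given
   by integers, within one closed piece of any given Sigma^0_2 set that contains
   the equivalence relation, and it thus belongs to every Pi^0_3 relation that
   contains the latter.  Another Polish topology with the same Borel sets agrees
   with the original one on a comeager set of parameters. *)

Require Import Defs.
From mathcomp Require Import all_boot all_order all_algebra.
From mathcomp Require Import all_classical all_reals all_analysis.
From mathcomp Require Import lra zify.

Set Implicit Arguments.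
Unset Strict Implicit.
Unset Printing Implicit Defensive.

Import Order.TTheory GRing.Theory Num.Theory.

Local Open Scope classical_set_scope.

(** * Baire category in spaces of functions to nat *)

Section finite_agreement.
Variable K : countType.
Implicit Types (p q : K -> nat) (U A : set (K -> nat)) (F : set K).

Definition agree F p q := forall k, F k -> p k = q k.

(** Neighbourhoods in the product of discrete copies of [nat]; [fopen] and [fdense] are openness and
    density there. *)
Definition fnear p A := exists2 F, finite_set F & agree F p `<=` A.

Definition fopen U := forall p, U p -> fnear p U.

Definition fdense U :=
  forall p F, finite_set F -> exists2 q, agree F p q & U q.

Definition comeager A := exists U : nat -> set (K -> nat),
  [/\ forall k, fopen (U k), forall k, fdense (U k) & \bigcap_k U k `<=` A].

Lemma agree_refl F p : agree F p p. Proof. by []. Qed.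

Lemma agree_trans F p q r : agree F p q -> agree F q r -> agree F p r.
Proof. by move=> h h' k Fk; rewrite h// h'. Qed.

Lemma agreeU F F' p q : agree (F `|` F') p q -> agree F p q /\ agree F' p q.
Proof. by move=> h; split=> k Fk; apply: h; [left|right]. Qed.

Lemma fnearW p A B : A `<=` B -> fnear p A -> fnear p B.
Proof. by move=> AB [F ? FA]; exists F => // q /FA /AB. Qed.

Lemma fnearI p A B : fnear p A -> fnear p B -> fnear p (A `&` B).
Proof.
move=> [F fF FA] [F' fF' FB]; exists (F `|` F'); first by rewrite finite_setU.
by move=> q /agreeU[/FA ? /FB].
Qed.

Lemma fnear_bigcap (I : choiceType) (D : set I) (A : I -> set (K -> nat)) p :
  finite_set D -> (forall i, D i -> fnear p (A i)) ->
  fnear p (\bigcap_(i in D) A i).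
Proof.
move=> fD nA; have /choice[F FP] : forall i, exists F,
    D i -> finite_set F /\ agree F p `<=` A i.
  move=> i; have [/nA[F fF FA]|?] := pselect (D i); first by exists F.
  by exists set0.
exists (\bigcup_(i in D) F i).
  by apply: bigcup_finite => // i /FP[].
move=> q pq i Di; have [_] := FP _ Di; apply => k Fk.
by apply: pq; exists i.
Qed.

Lemma fopen_interior A : fopen [set p | fnear p A].
Proof.
by move=> p [F fF FA]; exists F => // q pq; exists F => // r /(agree_trans pq)/FA.
Qed.

(** Finite conditions are extended in stages: stage [n] enters [U n] and also freezes the coordinate
    with code [n], so that a limit point exists. *)
Lemma Baire_comeager A : comeager A -> fdense A.
Proof.
move=> [U [oU dU UA]] p0 F0 fF0.
pose good := [set s : (K -> nat) * set K | finite_set s.2].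
have /choice[step stepP] : forall s : nat * ((K -> nat) * set K), exists t,
    good s.2 -> [/\ good t, agree s.2.2 s.2.1 t.1, s.2.2 `<=` t.2,
      [set k | pickle k = s.1] `<=` t.2 & agree t.2 t.1 `<=` U s.1].
  move=> [n [p F]]; have [fF|nF] := pselect (good (p, F)); last by exists (p, F).
  have [q pq Uq] := dU n p F fF; have [F' fF' F'U] := oU n q Uq.
  exists (q, F `|` F' `|` [set k | pickle k = n]) => _; split => //=.
  - rewrite /good /= !finite_setU; split=> //.
    apply: (@sub_finite_set _ _ (oapp (fun k => [set k]) set0 (unpickle n))).
      by move=> k /= <-; rewrite pickleK.
    by case: (unpickle n) => [k|] /=; [exact: finite_set1|].
  - by move=> k Fk; left; left.
  - by move=> r /agreeU[/agreeU[_ /F'U ?] _].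
pose s := fix s n := if n is m.+1 then step (m, s m) else (p0, F0).
have sg n : good (s n) by elim: n => //= n IH; case: (stepP (n, s n) IH).
have sS m n : (m <= n)%N -> (s m).2 `<=` (s n).2 /\ agree (s m).2 (s m).1 (s n).1.
  elim: n => [|n IH]; first by rewrite leqn0 => /eqP ->; split.
  rewrite leq_eqVlt => /predU1P[->|]; [by split|rewrite ltnS => /IH[Fmn pmn]].
  have [_ /= pq FF _ _] := stepP (n, s n) (sg n).
  split; first exact: subset_trans FF.
  by move=> k Fk; rewrite pmn// pq//; apply: Fmn.
(* Coordinate [k] is frozen from stage [(pickle k).+1] on. *)
pose q k := (s (pickle k).+1).1 k.
have qE n : agree (s n).2 (s n).1 q.
  move=> k Fk; have [np|pn] := leqP n (pickle k).+1.
    by have [_ ->] := sS _ _ np.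
  have [_ <- //] := sS _ _ (ltnW pn).
  by have [_ _ _ h _] := stepP (pickle k, s (pickle k)) (sg _); exact: h.
exists q; first exact: (qE 0).
apply: UA => n _; have [_ _ _ _] := stepP (n, s n) (sg n); apply.
exact: (qE n.+1).
Qed.

Lemma comeagerW A B : A `<=` B -> comeager A -> comeager B.
Proof. by move=> AB [U [oU dU UA]]; exists U; split=> // p /UA /AB. Qed.

Lemma comeagerT : comeager setT.
Proof.
by exists (fun=> setT); split=> // _ p; [exists set0|exists p].
Qed.

Lemma comeager_open U : fopen U -> fdense U -> comeager U.
Proof. by move=> oU dU; exists (fun=> U); split=> // p /(_ 0); apply. Qed.

Lemma comeager_bigcap (T : countType) (A : T -> set (K -> nat)) :
  (forall i, comeager (A i)) -> comeager (\bigcap_i A i).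
Proof.
move=> /choice[U UP].
exists (fun n => if @unpickle (T * nat)%type n is Some x then U x.1 x.2 else setT).
split=> [n|n|p pU i _].
- by case: unpickle => [x|]; [case: (UP x.1)|exists set0].
- by case: unpickle => [x|]; [case: (UP x.1)|move=> p; exists p].
- have [_ _] := UP i; apply => n _.
  by have := pU (pickle (i, n)) I; rewrite pickleK.
Qed.

Lemma comeagerI A B : comeager A -> comeager B -> comeager (A `&` B).
Proof.
move=> cA cB; have : comeager (\bigcap_b (if b then A else B)).
  by apply: comeager_bigcap => -[].
by apply: comeagerW => p h; split; [apply: (h true)|apply: (h false)].
Qed.

Definition rel_clopen G A := forall p, G p ->
  fnear p [set q | G q -> (A q <-> A p)].

(* The boundary of a set which is relatively open in [G] is nowhere dense, so
   removing it from [G] makes the set relatively clopen. *)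
Lemma rel_open_clopen G A : comeager G ->
  (forall p, G p -> A p -> fnear p [set q | G q -> A q]) ->
  exists2 G', comeager G' & rel_clopen G' A.
Proof.
move=> cG oA; pose O := [set p | fnear p [set q | G q -> A q]].
pose D := O `|` [set p | fnear p (~` O)].
exists (G `&` D).
  apply: comeagerI => //; apply: comeager_open.
    move=> p [Op|np].
      by apply: fnearW (fopen_interior Op) => q; left.
    by apply: fnearW (fopen_interior np) => q; right.
  move=> p F fF; have [[q pq Oq]|nO] := pselect (exists2 q, agree F p q & O q).
    by exists q => //; left.
  by exists p => //; right; exists F => // q pq Oq; apply: nO; exists q.
have OA p : G p -> A p <-> O p.
  move=> Gp; split; first exact: oA.
  by move=> [F fF] /(_ p (agree_refl _))/(_ Gp).
move=> p [Gp [Op|nOp]].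
  apply: fnearW (fopen_interior Op) => q Oq [Gq _].
  by rewrite !OA.
move: (nOp); apply: fnearW => q nOq [Gq _]; rewrite !OA//; split=> // Op.
by have [F fF /(_ p (agree_refl _))] := nOp.
Qed.

(** This is the Baire property of Borel preimages. A countable union is a priori only relatively
    open on the common comeager set, and [rel_open_clopen] shrinks that set further. *)
Lemma sigma_algebra_clopen (X : Type) (f : (K -> nat) -> X) :
  sigma_algebra setT
    [set A : set X | exists2 G, comeager G & rel_clopen G (f @^-1` A)].
Proof.
split=> [|A [G cG GA]|A hA].
- by exists setT; [exact: comeagerT|move=> p _; exists set0].
- exists G => // p Gp; apply: fnearW (GA p Gp) => q /= /[apply] h.
  by split=> -[_ nA]; split=> // /h.
- have [G [cG GA]] : exists G : nat -> set (K -> nat),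
      (forall n, comeager (G n)) /\ forall n, rel_clopen (G n) (f @^-1` (A n)).
    have /choice[G GP] : forall n, exists G, comeager G /\ rel_clopen G (f @^-1` (A n)).
      by move=> n; have [G] := hA n; exists G.
    by exists G; split=> n; case: (GP n).
  apply: (@rel_open_clopen (\bigcap_n G n)); first exact: comeager_bigcap.
  move=> p Gp [n _ Anp]; apply: fnearW (GA n p (Gp n I)) => q h Gq.
  by exists n => //; apply/(h (Gq n I)).
Qed.

End finite_agreement.

(* [q \o s q] is, locally in the coordinates [D], a rearrangement of part of the
   remaining coordinates; hence it is generic when [q] is. *)
Lemma comeager_reindex (K J : countType) (D : set K) (s : (K -> nat) -> J -> K)
    (A : set (J -> nat)) :
  (forall q, injective (s q)) -> (forall q j, ~ D (s q j)) ->
  (forall q r, agree D q r -> s q = s r) ->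
  (forall q j, fnear q [set r | r (s r j) = q (s q j)]) ->
  comeager A -> comeager [set q : K -> nat | A (q \o s q)].
Proof.
move=> sI sD sE sC [U [oU dU UA]].
exists (fun n => [set q : K -> nat | U n (q \o s q)]); split=> [n q Uq|n q F fF|q qU].
- have [F fF FU] := oU n _ Uq.
  apply: fnearW (fnear_bigcap fF (fun j _ => sC q j)) => r h.
  by apply: FU => j Fj /=; rewrite -(h j Fj).
- have [p pq Up] := dU n (q \o s q) (s q @^-1` F) (finite_preimage (in2W (sI q)) fF).
  (* [r] copies [p] along the range of [s q] and equals [q] elsewhere. The range avoids [D], so
     [s r = s q]. *)
  have /choice[r rP] : forall k, exists m,
      (forall j, k = s q j -> m = p j) /\ ((forall j, k <> s q j) -> m = q k).
    move=> k; have [[j ->]|nk] := pselect (exists j, k = s q j).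
      by exists (p j); split=> [i /sI -> //|/(_ j)].
    by exists (q k); split=> // j kj; case: nk; exists j.
  have rs j : r (s q j) = p j by have [+ _] := rP (s q j); apply.
  have rn k : (forall j, k <> s q j) -> r k = q k by have [_ +] := rP k; apply.
  exists r.
    move=> k Fk; have [[j kj]|nk] := pselect (exists j, k = s q j).
      by rewrite kj rs -pq//= /preimage /= -kj.
    by rewrite rn// => j kj; apply: nk; exists j.
  have sqr : s r = s q.
    by apply/esym/sE => k Dk; rewrite rn// => j kj; apply: (sD q j); rewrite -kj.
  rewrite /= sqr; suff -> : r \o s q = p by [].
  by apply/funext => j /=; apply: rs.
- by apply: UA => n _; apply: qU.
Qed.

(** * Changes of Polish topology *)

Lemma cvg_prod_topology (I : Type) (T : I -> topologicalType)
    (F : set_system (prod_topology T)) (f : prod_topology T) :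
  Filter F -> (forall i, (fun g => g i) @ F --> f i) -> F --> f.
Proof.
move=> FF Ff; apply/cvg_sup => i A [_ [[V oV <-] Vf VA]].
apply: (filterS VA); apply: (Ff i).
by apply: open_nbhs_nbhs.
Qed.

Section fnear_topology.
Variable K : countType.

Local Instance fnear_filter (p : K -> nat) : Filter (fnear p).
Proof.
split; first by exists set0.
- exact: fnearI.
- exact: fnearW.
Qed.

Lemma fnear_open (G : Type) (f : (K -> nat) -> {ptws G -> cantor_space})
    (U : set {ptws G -> cantor_space}) p :
  (forall a n, fnear p [set q | f q a n = f p a n]) ->
  open U -> U (f p) -> fnear p (f @^-1` U).
Proof.
move=> fc oU Ufp; have : fmap f (fnear p) --> f p.
  apply: cvg_prod_topology => a; apply: cvg_prod_topology => n A.
  rewrite nbhs_principalE => /principal_filterP Ap.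
  by apply: filterS (fc a n) => q /= ->.
by apply; apply: open_nbhs_nbhs.
Qed.

End fnear_topology.

Lemma polish_second_countable (R : realType) (Y : topologicalType) :
  polish R Y -> exists W : nat * nat -> set Y, (forall k, open (W k)) /\
    forall U y, open U -> U y -> exists k, W k y /\ W k `<=` U.
Proof.
move=> [[D /countable_injP[g gI] dD] [m []]].
set M := Metric.Pack m : metricType R => oM _.
pose r n : R := (n.+1%:R^-1)%R.
have r0 n : (0 < r n)%R by rewrite invr_gt0 ltr0n.
pose B (d : Y) n : set M := ball (d : M) (r n).
(* At most one [d] in [D] has code [k.1]; the union gives the empty set when there is none. *)
exists (fun k => \bigcup_(d in D `&` [set d | g d = k.1]) interior (B d k.2)).
split=> [k|U y oU Uy].
  by rewrite -oM; apply: bigcup_open => d _; exact: open_interior.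
have : nbhs (y : M) (U : set M) by apply: open_nbhs_nbhs; split=> //; rewrite oM.
move=> /nbhs_ballP[e /= e0 eU].
have [n rn] : exists n, (r n + r n <= e)%R.
  have e2 : (0 < e / 2)%R by lra.
  have [n _ /(_ n (leqnn n)) h] := near_infty_natSinv_lt (PosNum e2).
  by exists n; move: h => /=; rewrite -/(r n); lra.
have r2 : (0 < r n / 2)%R by have := r0 n; lra.
have [d [yd Dd]] : interior (ball (y : M) (r n / 2)) `&` D !=set0.
  apply: dD; last by rewrite -oM; exact: open_interior.
  by exists y; apply: nbhsx_ballx.
exists (g d, n); split; first exists d => //=.
  apply/nbhs_ballP; exists (r n / 2)%R => //= z yz.
  rewrite /B (splitr (r n)); apply: ball_triangle yz.
  by apply: ball_sym; exact: interior_subset yd.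
move=> z [d' /= [D' gdd]]; have -> : d' = d by apply: gI; rewrite ?inE.
move=> /interior_subset dz; apply: eU.
have yd' := interior_subset yd.
apply: le_ball (_ : (r n / 2 + r n <= e)%R) _ _; first by have := r0 n; lra.
exact: ball_triangle yd' dz.
Qed.

(** Each set of a countable base of [Y] has a preimage that is clopen relative to some comeager set;
    on the intersection of these sets the map is continuous. *)
Lemma Borel_comeager_continuous (R : realType) (K : countType)
    (X Y : topologicalType) (f : (K -> nat) -> X) (h : X -> Y) :
  (forall p U, open U -> U (f p) -> fnear p (f @^-1` U)) ->
  polish R Y -> (forall V, borel Y V -> borel X (h @^-1` V)) ->
  exists2 C, comeager C & forall p U, C p -> open U -> U (h (f p)) ->
    fnear p [set q | C q -> U (h (f q))].
Proof.
move=> fc /polish_second_countable[W [oW WU]] hYX.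
have clopen A : borel X A ->
    exists2 G, comeager G & rel_clopen G (f @^-1` A).
  move=> bA; apply: (bA [set A | exists2 G, comeager G & rel_clopen G (f @^-1` A)]).
  split; first exact: sigma_algebra_clopen.
  move=> U oU; apply: (rel_open_clopen (@comeagerT _)) => p _ /(fc _ _ oU).
  by apply: fnearW => q Uq _.
have /choice[G GP] : forall k, exists G, comeager G /\
    rel_clopen G (f @^-1` (h @^-1` (W k))).
  move=> k; have [|G] := clopen (h @^-1` (W k)); last by exists G.
  by apply: hYX; apply: sub_sigma_algebra.
exists (\bigcap_k G k).
  by apply: comeager_bigcap => k; case: (GP k).
move=> p U Gp oU Ufp; have [k [Wk WkU]] := WU _ _ oU Ufp.
apply: fnearW ((GP k).2 p (Gp k I)) => q /= Wq Gq.
by apply: WkU; apply/(Wq (Gq k I)).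
Qed.

(** * Rotations by 2-adic integers *)

(** A generic point of [A] lies in some [B m] and in [G m], so nearby points of [G m] lie in [B m]
    too. As [B m] is relatively closed in [A], this extends to all nearby points of [A]. *)
Lemma comeager_cover (K : countType) (A : set (K -> nat))
    (B : nat -> set (K -> nat)) :
  comeager A -> A `<=` \bigcup_m B m ->
  (forall m p, A p -> ~ B m p -> fnear p [set q | A q -> ~ B m q]) ->
  fdense [set p | exists m, fnear p [set q | A q -> B m q]].
Proof.
move=> cA AB cB p F fF.
have /choice[G GP] : forall m, exists G, comeager G /\ rel_clopen G (~` B m).
  by move=> m; have [G] := rel_open_clopen cA (cB m); exists G.
have cG : comeager (A `&` \bigcap_m G m).
  by apply: comeagerI => //; apply: comeager_bigcap => m; case: (GP m).
have [q pq [Aq Gq]] := Baire_comeager cG p fF.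
exists q => //; have [m _ Bq] := AB q Aq; exists m.
have [F' fF' F'G] := (GP m).2 q (Gq m I).
exists F' => // r qr Ar; apply: contrapT => nBr.
have [F'' fF'' F''B] := cB m r Ar nBr.
have fU : finite_set (F' `|` F'') by rewrite finite_setU.
have [s /agreeU[rs rs'] [As Gs]] := Baire_comeager cG r fU.
apply: ((F'G s (agree_trans qr rs) (Gs m I)).1 _ Bq).
exact: F''B.
Qed.

Lemma finite_set_bounded (T : Type) (F : set T) (g : T -> nat) :
  finite_set F -> exists N, forall t, F t -> (g t < N)%N.
Proof.
move=> fF; have /finite_seqP[s sE] := finite_image g fF.
exists (\max_(x <- s) x).+1 => t Ft; rewrite ltnS.
have : [set` s] (g t) by rewrite -sE; exists t.
by move=> /= ts; apply: (@leq_bigmax_seq _ _ xpredT id).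
Qed.

(* A cell [(i, c, n)] is bit [n] of entry [c] of sheet [i]; entries [c >= 2 ^ i]
   are junk.  A slot [xc j] or [zc j] holds the bit of the original, respectively
   its replacement, at cell [j]; [hc i] holds the cut-off of sheet [i] and [dc j]
   holds digit [j] of a 2-adic integer (any natural number is a valid digit). *)
Definition cell : countType := (nat * nat * nat)%type.

Definition slot : countType := (cell + cell + (nat + nat))%type.

Definition xc (j : cell) : slot := inl (inl j).
Definition zc (j : cell) : slot := inl (inr j).
Definition hc (i : nat) : slot := inr (inl i).
Definition dc (i : nat) : slot := inr (inr i).

Definition odometer (q : slot -> nat) i : nat := \sum_(j < i) q (dc j) * 2 ^ j.

(** Fixing the junk entries [c >= m] makes the rotation injective on all of [nat]. *)
Definition shiftmod (m g c : nat) : nat := if (c < m)%N then (c + g) %% m else c.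

(** The slot from which the image reads its cell [j], so that the image is [q \o ysrc q]. *)
Definition ysrc (q : slot -> nat) (j : cell) : slot :=
  let: (i, c, n) := j in
  if (n < q (hc i))%N then zc j else xc (i, shiftmod (2 ^ i) (odometer q i) c, n).

(** Zeroing the digits from [l] on turns the 2-adic integer into a natural number. *)
Definition trunc l (q : slot -> nat) (k : slot) : nat :=
  if k is inr (inr j) then if (j < l)%N then q k else 0 else q k.

Lemma shiftmod_inj m g : injective (shiftmod m g).
Proof.
rewrite /shiftmod => c c'; have [cm|mc] := ltnP c m; have [c'm|mc'] := ltnP c' m => //.
- move=> /eqP; rewrite eqn_modDr => /eqP.
  by rewrite !modn_small.
- have := ltn_pmod (c + g) (leq_ltn_trans (leq0n _) cm); lia.
- have := ltn_pmod (c' + g) (leq_ltn_trans (leq0n _) c'm); lia.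
Qed.

Lemma ysrc_inj q : injective (ysrc q).
Proof.
move=> [[i c] n] [[i' c'] n'] /=; case: ifP => h; case: ifP => h' //.
- by case=> -> -> ->.
- by case=> ii /[swap] nn; rewrite ii => /shiftmod_inj ->; rewrite nn.
Qed.

Lemma ysrc_inl q j : exists j', ysrc q j = inl j'.
Proof. by case: j => [[i c] n] /=; case: ifP; eexists. Qed.

Lemma agree_odometer i q r :
  (forall j, (j < i)%N -> q (dc j) = r (dc j)) -> odometer q i = odometer r i.
Proof. by move=> qr; apply: eq_bigr => j _; rewrite qr. Qed.

Lemma agree_trunc l F q r : agree F q r -> agree F (trunc l q) (trunc l r).
Proof. by move=> qr [k|[k|k]] Fk /=; rewrite qr. Qed.

Section ypart.
Variable t : (slot -> nat) -> slot -> nat.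
Hypothesis agree_t : forall F q r, agree F q r -> agree F (t q) (t r).

(** The source of a cell of sheet [i] depends only on the cut-off [i] and the digits below [i]. The
    maps [t] of interest are [id] and [trunc l]. *)
Lemma fnear_ysrc q j : fnear q [set r | r (ysrc (t r) j) = q (ysrc (t q) j)].
Proof.
case: j => [[i c] n].
exists ([set hc i] `|` (dc @` `I_i) `|` [set ysrc (t q) (i, c, n)]).
  rewrite !finite_setU; split; first split; try exact: finite_set1.
  exact/finite_image/finite_II.
move=> r /agreeU[/agreeU[/agree_t hr /agree_t dr] qr].
have E : ysrc (t r) (i, c, n) = ysrc (t q) (i, c, n).
  rewrite /ysrc -hr//; case: ifP => // _; congr (xc (_, shiftmod _ _ _, _)).
  by apply/esym/agree_odometer => j ji; apply: dr; exists j.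
by rewrite /mkset E qr.
Qed.

Lemma comeager_ysrc A : comeager A -> comeager [set q : slot -> nat | A (q \o ysrc (t q))].
Proof.
apply: (@comeager_reindex _ _ (range (@inr (cell + cell)%type (nat + nat)%type))).
- by move=> q; exact: ysrc_inj.
- by move=> q j [k _]; have [j' ->] := ysrc_inl (t q) j.
- move=> q r /agree_t qr; apply/funext => -[[i c] n].
  rewrite /ysrc qr; last by exists (inl i).
  case: ifP => // _; congr (xc (_, shiftmod _ _ _, _)).
  by apply: agree_odometer => j _; apply: qr; exists (inr j).
- exact: fnear_ysrc.
Qed.

End ypart.

Lemma comeager_xc A : comeager A -> comeager [set q : slot -> nat | A (q \o xc)].
Proof.
apply: (@comeager_reindex _ _ set0 (fun=> xc)) => //.
- by move=> _ j j' [].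
- by move=> q j [].
- move=> q j; exists [set xc j]; first exact: finite_set1.
  by move=> r /= ->.
Qed.

(** Slots [xc] get level 0 because neither truncation nor the change of high sheets in
    [comeager_limit] alters them. *)
Definition level (k : slot) : nat :=
  match k with
  | inl (inl _) => 0
  | inl (inr (i, _, _)) => i
  | inr (inl i) => i
  | inr (inr j) => j
  end.

(* A generic [q \o ysrc q] is approximated by the [r \o ysrc (trunc l r)]: the
   truncation does not affect the sheets on which the basic open set in question
   prescribes cut-offs, and on the other sheets a large cut-off allows any
   finite modification. *)
Lemma comeager_limit (C : set (cell -> nat))
    (B : nat -> (cell -> nat) -> (cell -> nat) -> Prop) :
  comeager C ->
  (forall m p p', C p -> C p' -> ~ B m p p' -> exists2 F, finite_set F &
    forall r r', C r -> C r' -> agree F p r -> agree F p' r' -> ~ B m r r') ->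
  (forall l q, C (q \o xc) -> C (q \o ysrc (trunc l q)) ->
    exists m, B m (q \o xc) (q \o ysrc (trunc l q))) ->
  comeager [set q : slot -> nat | exists m, B m (q \o xc) (q \o ysrc q)].
Proof.
move=> cC Bcl BE.
pose y l (q : slot -> nat) := q \o ysrc (trunc l q).
pose A l := [set q : slot -> nat | C (q \o xc) /\ C (y l q)].
have cA l : comeager (A l).
  apply: comeagerI; first exact: comeager_xc.
  by apply: (comeager_ysrc (t := trunc l)) => // F q r; exact: agree_trunc.
pose A' := [set q : slot -> nat | C (q \o xc) /\ C (q \o ysrc q)].
have cA' : comeager A'.
  apply: comeagerI; first exact: comeager_xc.
  exact: (comeager_ysrc (t := id)).
pose S := [set q : slot -> nat | A' q -> exists m, B m (q \o xc) (q \o ysrc q)].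
suff dS : fdense [set q | fnear q S].
  apply: comeagerW (comeagerI cA' (comeager_open (@fopen_interior _ S) dS)).
  by move=> q [A'q [F fF]]; apply.
have ynear l q (F : set cell) : finite_set F ->
    fnear q [set r : slot -> nat | agree F (q \o xc) (r \o xc) /\ agree F (y l q) (y l r)].
  move=> fF; apply: fnearW (fnearI (fnear_bigcap fF _)
    (fnear_bigcap fF (fun j _ => fnear_ysrc (@agree_trunc l) q j))).
    move=> r [xr yr]; split; first exact: xr.
    by move=> j Fj; apply/esym; exact: yr.
  move=> j _; exists [set xc j]; first exact: finite_set1.
  by move=> r; apply.
move=> q0 F0 fF0; have [l lP] := finite_set_bounded level fF0.
pose Bl m := [set q : slot -> nat | B m (q \o xc) (y l q)].
have dl : fdense [set p : slot -> nat | exists m,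
    fnear p [set q | A l q -> Bl m q]].
  apply: (comeager_cover (cA l)).
    by move=> q [Cx Cy]; have [m Bm] := BE l q Cx Cy; exists m.
  move=> m q [Cx Cy] nB; have [F fF FB] := Bcl m _ _ Cx Cy nB.
  by apply: fnearW (ynear l q F fF) => r [xr yr] [Cxr Cyr]; apply: FB.
have [q1 q01 [m [F1 fF1 F1B]]] := dl q0 F0 fF0.
(* Digits from [l] on do not enter [y l], so they may be borrowed from [q1]. *)
have {}F1B r : agree F1 (trunc l q1) r -> A l r -> B m (r \o xc) (y l r).
  move=> q1r Ar.
  pose r' k := if k is inr (inr j) then if (j < l)%N then r k else q1 k else r k.
  have yr' : y l r' = y l r.
    have tr : trunc l r' = trunc l r.
      by apply/funext => -[k|[k|k]] //=; case: ltnP.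
    rewrite /y tr; apply/funext => j /=.
    by have [k ->] := ysrc_inl (trunc l r) j.
  have Ar' : A l r' by rewrite /A /mkset yr'.
  suff q1r' : agree F1 q1 r' by have := F1B r' q1r' Ar'; rewrite /Bl /mkset yr'.
  by move=> [k|[k|k]] Fk; have := q1r _ Fk => //=; case: ltnP.
exists (trunc l q1).
  move=> k Fk; have := lP k Fk; rewrite q01//.
  by case: k Fk => [k|[k|k]] _ //= ->.
have [L0 L0P] := finite_set_bounded level fF1.
pose L := maxn l L0.
exists (F1 `|` dc @` `I_L).
  by rewrite finite_setU; split=> //; exact/finite_image/finite_II.
move=> q /agreeU[q1q dq] [Cx Cy]; exists m; apply: contrapT => nB.
have [F3 fF3 F3B] := Bcl m _ _ Cx Cy nB.
have [N NP] := finite_set_bounded snd fF3.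
(* Sheets below [L] are kept from [q]; on the others the cut-off [N] lets the replacement bits copy
   the image of [q] on [F3]. So [q3] meets the condition [F1], and its truncated image agrees with
   that of [q] on [F3]. *)
pose q3 (k : slot) := match k with
  | inl (inr j) => if (j.1.1 < L)%N then q k else q (ysrc q j)
  | inr (inl i) => if (i < L)%N then q k else N
  | inr (inr j) => if (j < l)%N then q k else 0
  | _ => q k
  end.
have q1q3 : agree F1 (trunc l q1) q3.
  move=> k Fk; have := L0P k Fk; have := q1q k Fk.
  case: k Fk => [[k|[[i c] n]]|[k|k]] Fk //= e kL0.
  - by rewrite e (leq_trans kL0) ?leq_maxr.
  - by rewrite e (leq_trans kL0) ?leq_maxr.
  - by move: e; case: ltnP.
have yq3 : agree F3 (q \o ysrc q) (y l q3).
  move=> [[i c] n] Fj; have /= nN := NP _ Fj.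
  rewrite /y /=; have [iL|Li] := ltnP i L; last by rewrite nN /= (ltnNge i) Li.
  case: ifP => // _; first by rewrite /= iL.
  rewrite /=; congr (q (xc (_, shiftmod _ _ _, _))).
  apply: agree_odometer => j ji /=.
  (* Below [L], the digits of [q] from [l] on vanish, so truncation does not change the rotation. *)
  have {}dq : trunc l q1 (dc j) = q (dc j).
    by apply: dq; exists j => //=; apply: ltn_trans iL.
  by move: dq => /=; case: ltnP.
have [F4 fF4 F4P] := ynear l q3 F3 fF3.
have fF14 : finite_set (F1 `|` F4) by rewrite finite_setU.
(* The pair given by a generic [r] near [q3] lies in the piece [m] by [F1] and outside it by
   [F3]. *)
have [r /agreeU[q3r /F4P[xr yr]] Ar] := Baire_comeager (cA l) q3 fF14.
have [Cxr Cyr] := Ar.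
apply: (F3B (r \o xc) (y l r)) => //; first exact: agree_trans yr.
by apply: F1B => //; exact: agree_trans q3r.
Qed.

(** * The jump of E_0 *)

Definition residue (i : nat) (a : int) : nat := `|(a %% Posz (2 ^ i))%Z|%N.

Definition array (p : cell -> nat) : {ptws Z2 -> cantor_space} :=
  fun a n => odd (p (`|a.2|%N, residue `|a.2| a.1, n)).

Lemma residue_lt i a : (residue i a < 2 ^ i)%N.
Proof.
by rewrite /residue; have := expn_gt0 2 i; lia.
Qed.

Lemma residueD i g a : residue i (Posz g + a)%R = ((residue i a + g) %% 2 ^ i)%N.
Proof.
rewrite /residue; apply/eqP; rewrite -eqz_nat -modz_nat; apply/eqP.
have m0 : Posz (2 ^ i) != 0%R by rewrite eqz_nat -lt0n expn_gt0.
rewrite !gez0_abs ?modz_ge0// PoszD gez0_abs ?modz_ge0//.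
by rewrite modzDml addrC.
Qed.

Lemma odometerS q i : odometer q i.+1 = (odometer q i + q (dc i) * 2 ^ i)%N.
Proof. by rewrite /odometer big_ord_recr. Qed.

Lemma odometer_mod q i l : (i <= l)%N -> odometer q l = odometer q i %[mod 2 ^ i].
Proof.
elim: l => [|l IH]; first by rewrite leqn0 => /eqP ->.
rewrite leq_eqVlt => /predU1P[-> //|]; rewrite ltnS => il; rewrite -IH// odometerS.
have -> : (2 ^ l = 2 ^ (l - i) * 2 ^ i)%N by rewrite -expnD subnK.
by rewrite mulnA -modnDmr modnMl addn0.
Qed.

Lemma odometer_trunc l q i :
  odometer (trunc l q) i = odometer q l %[mod 2 ^ i].
Proof.
have [il|li] := leqP i l.
  rewrite (odometer_mod _ il); congr (_ %% _)%N.
  by apply: agree_odometer => j ji /=; rewrite (leq_trans ji).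
congr (_ %% _)%N; rewrite -(subnK (ltnW li)) addnC; elim: (i - l)%N => [|k IH].
  by rewrite addn0; apply: agree_odometer => j jl /=; rewrite jl.
by rewrite addnS odometerS IH /= ltnNge leq_addr addn0.
Qed.

Lemma jump_trunc l q :
  jump (G := Z2) E0 (array (q \o xc)) (array (q \o ysrc (trunc l q))).
Proof.
(* [jump] translates by the inverse, hence the inverse of the integer spelled by the first [l]
   digits. From the cut-off on, both sides agree. *)
exists (((Posz (odometer q l), 0%R) : Z2)^-1)%g => a; rewrite invgK.
have -> : (((Posz (odometer q l), 0%R) : Z2) * a)%g = ((Posz (odometer q l) + a.1)%R, a.2) :> Z2.
  by case: a => a b; congr pair; rewrite /= add0r.
apply: (sub_finite_set _ (finite_II (q (hc `|a.2|%N)))) => n /= ne.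
rewrite ltnNge; apply/negP => qn; apply: ne.
rewrite /array /= ltnNge qn /= /shiftmod residue_lt residueD.
by rewrite -[in RHS]modnDmr odometer_trunc modnDmr.
Qed.

Definition E0_inequivalent (q : slot -> nat) : Prop :=
  forall u v : nat * nat, u <> v -> forall N : nat, exists2 n, (N <= n)%N &
    odd (q (xc (u, n))) != odd (q (xc (v, n))).

(** The 2-adic integer coded by the digits is not an integer, negative ones included. *)
Definition odometer_nonstandard (q : slot -> nat) : Prop :=
  forall a : int, exists i, odometer q i <> residue i a %[mod 2 ^ i].

(** By inequivalence, a translation must match entries exactly. Entry 0 of each sheet then shows
    that it fixes the sheets and that its first coordinate has the residues of the 2-adic
    integer. *)
Lemma not_jump q : E0_inequivalent q -> odometer_nonstandard q ->
  ~ jump (G := Z2) E0 (array (q \o xc)) (array (q \o ysrc q)).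
Proof.
move=> qx qd [g]; set a := (g^-1)%g => ag.
have ax b : (`|(a.2 + b)%R|%N, residue `|(a.2 + b)%R| a.1) =
            (`|b|%N, (odometer q `|b| %% 2 ^ `|b|)%N).
  apply: contrapT => /qx ne; have [N NP] := finite_set_bounded id (ag ((0%R, b) : Z2)).
  (* Bit [n] lies past all [E0] differences and past the cut-off, so the image reads it from the
     original. *)
  have [n nN /eqP] := ne (maxn N (q (hc `|b|%N))); apply; apply: contrapT => ne'.
  have := NP n; rewrite /= ltnNge (leq_trans _ nN) ?leq_maxl// => h.
  suff : false by []; apply: h => /= E; apply: ne'; move: E.
  have -> : (a * ((0%R, b) : Z2))%g = (a.1, (a.2 + b)%R) :> Z2.
    by case: (a) => a1 a2; congr pair; rewrite /= addr0.
  have r0 : residue `|b| 0%R = 0%N by rewrite /residue mod0z.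
  rewrite /array /= r0 ltnNge (leq_trans _ nN) ?leq_maxr//=.
  by rewrite /shiftmod expn_gt0 add0n.
have a0 : a.2 = 0%R by have := ax 0%R; rewrite addr0 => -[/eqP]; rewrite absz_eq0 => /eqP.
have [i] := qd a.1; apply; have := ax (Posz i).
by rewrite a0 add0r => -[->]; rewrite modn_mod.
Qed.

Lemma comeager_E0_inequivalent : comeager E0_inequivalent.
Proof.
apply: comeagerW (@comeager_bigcap _ ((nat * nat) * (nat * nat) * nat)%type
  (fun w => [set q | w.1.1 <> w.1.2 -> exists2 n, (w.2 <= n)%N &
    odd (q (xc (w.1.1, n))) != odd (q (xc (w.1.2, n)))]) _).
  by move=> q qw u v uv N; apply: (qw (u, v, N) I).
move=> [[u v] N]; have [->|/eqP uv] := eqVneq u v.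
  by apply: comeagerW (@comeagerT _) => q _ /=.
pose snd_cell (k : slot) := match k with inl (inl j) => j.2 | _ => 0%N end.
apply: comeager_open => [q|q F fF] /=.
  move=> /(_ uv)[n Nn ne]; exists [set xc (u, n); xc (v, n)].
    by rewrite finite_setU; split; exact: finite_set1.
  move=> r qr _; exists n => //.
  by have [<- <-] : q (xc (u, n)) = r (xc (u, n)) /\ q (xc (v, n)) = r (xc (v, n));
    [split; apply: qr; [left|right]|].
have [M MP] := finite_set_bounded snd_cell fF.
pose n := maxn M N.
exists (fun k => if k == xc (u, n) then ~~ odd (q (xc (v, n))) : nat else q k).
  move=> k Fk; case: eqP => // kE; have := MP k Fk.
  by rewrite kE /= ltnNge leq_maxl.
move=> _; exists n; first exact: leq_maxr.
rewrite eqxx; case: (xc (v, n) =P _) => [[vu]|_]; first by rewrite vu in uv.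
by rewrite oddb; case: odd.
Qed.

Lemma comeager_odometer_nonstandard : comeager odometer_nonstandard.
Proof.
apply: comeagerW (@comeager_bigcap _ int
  (fun a => [set q | exists i, odometer q i <> residue i a %[mod 2 ^ i]]) _).
  by move=> q qa a; apply: (qa a I).
move=> a; apply: comeager_open => [q [i qi]|q F fF] /=.
  exists (dc @` `I_i); first exact/finite_image/finite_II.
  move=> r qr; exists i; rewrite -(@agree_odometer i q)// => j ji.
  by apply: qr; exists j.
have [j jP] := finite_set_bounded level fF.
pose r v k := if k == dc j then v else q k.
(* The values 0 and 1 of the free digit [j] give distinct residues, so one of them differs from that
   of [a]. *)
suff [v rv] : exists v, odometer (r v) j.+1 <> residue j.+1 a %[mod 2 ^ j.+1].
  exists (r v); last by exists j.+1.
  by move=> k Fk; rewrite /r; case: eqP => // kE; have := jP k Fk; rewrite kE /= ltnn.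
have rE v : odometer (r v) j.+1 = (odometer q j + v * 2 ^ j)%N.
  rewrite odometerS {2}/r eqxx; congr addn.
  apply: agree_odometer => i ij; rewrite /r; case: eqP => // -[ij'].
  by rewrite ij' ltnn in ij.
apply: contrapT => /forallNP nv.
have [/contrapT r0 /contrapT r1] := (nv 0%N, nv 1%N).
have /eqP : odometer (r 1%N) j.+1 = odometer (r 0%N) j.+1 %[mod 2 ^ j.+1].
  by rewrite r0 r1.
rewrite !rE eqn_modDl mul1n mul0n mod0n modn_small ?ltn_exp2l//.
by rewrite expn_eq0.
Qed.

Theorem theorem1p4 (R : realType) :
  ~ @potentially_Pi0 R 3 {ptws Z2 -> cantor_space} (jump (G := Z2) E0).
Proof.
move=> [tau []]; set Y := Topological.Pack tau : topologicalType.
move=> polY bY [F FP FE].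
(* The relation is the intersection over [n] of the unions over [m] of the closed sets [H n m]. *)
have /choice[H HP] : forall n, exists H : nat -> set (Y * Y)%type,
    (forall m, open (~` H m)) /\ ~` F n = \bigcup_m H m.
  by move=> n; have [H oH HE] := FP n; exists H.
have EH p p' : jump (G := Z2) E0 p p' <-> forall n, exists m, H n m (p, p').
  split=> [Epp' n|Hpp'].
    have : (~` F n) (p, p').
      move=> Fn; have : (\bigcup_i F i) (p, p') by exists n.
      by rewrite -FE; apply.
    by rewrite (HP n).2 => -[m _]; exists m.
  apply: contrapT => nE; have : (\bigcup_i F i) (p, p') by rewrite -FE.
  move=> [n _ Fn]; have [m Hm] := Hpp' n.
  have : (\bigcup_m H n m) (p, p') by exists m.
  by rewrite -(HP n).2; apply.
have arrayC p (U : set {ptws Z2 -> cantor_space}) :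
    open U -> U (array p) -> fnear p (array @^-1` U).
  move=> oU Up; apply: fnear_open => // a n.
  exists [set (`|a.2|%N, residue `|a.2| a.1, n)]; first exact: finite_set1.
  by move=> r pr; rewrite /array /= pr.
(* The identity into [Y] is Borel, so its composite with [array] is continuous when restricted to
   some comeager [C]. *)
have bXY V : borel Y V -> borel {ptws Z2 -> cantor_space} (idfun @^-1` V).
  by rewrite bY.
have [C cC Ccont] := Borel_comeager_continuous arrayC polY bXY.
have cH n : comeager [set q : slot -> nat | exists m,
    H n m (array (q \o xc), array (q \o ysrc q))].
  apply: (comeager_limit (B := fun m p p' => H n m (array p, array p')) cC).
  - move=> m p p' Cp Cp' nH; have oH := (HP n).1 m.
    have : nbhs ((array p, array p') : Y * Y) (~` H n m).
      by apply: open_nbhs_nbhs.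
    move=> [[U V] /= [nU nV] UV].
    have [G fG GU] : fnear p [set q | C q -> (U : set Y) (array q)].
      have : nbhs (array p : Y) U by exact: nU.
      rewrite nbhsE => -[U' [oU' U'p] U'U].
      by apply: fnearW (Ccont _ _ Cp oU' U'p) => q h /h /U'U.
    have [G' fG' GV] : fnear p' [set q | C q -> (V : set Y) (array q)].
      have : nbhs (array p' : Y) V by exact: nV.
      rewrite nbhsE => -[V' [oV' V'p] V'V].
      by apply: fnearW (Ccont _ _ Cp' oV' V'p) => q h /h /V'V.
    exists (G `|` G'); first by rewrite finite_setU.
    move=> r r' Cr Cr' /agreeU[pr _] /agreeU[_ pr'].
    by apply: UV; split; [exact: GU|exact: GV].
  - by move=> l q _ _; have /EH := jump_trunc l q.
have cq := comeagerI (comeager_bigcap cH)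
  (comeagerI comeager_E0_inequivalent comeager_odometer_nonstandard).
have [q _ [Hq [qx qd]]] := Baire_comeager cq (fun=> 0%N) (finite_set0 _).
by apply: (not_jump qx qd); apply/EH => n; exact: Hq.
Qed.
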